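(* Let $n\ge 3$. For $k=1$, two distinct vertices of $\mathrm{PX}(n,1)$ are twins if and only if either they lie in the same fibre, or $n=4$ and they lie in antipodal fibres. For $2\le k<n$, the graph $\mathrm{PX}(n,k)$ has no pair of twins.
   Context: For integers $n\ge 3$ and $1\le k<n$, the Praeger–Xu graph $\mathrm{PX}(n,k)$ is the simple graph with vertex set $\mathbb Z_n\times\mathbb Z_2^k$; a vertex is written $(i,x)$ with $x=x_0x_1\cdots x_{k-1}$ a bitstring of length $k$. Two vertices $(i,x)$ and $(j,y)$ are adjacent if and only if (after possibly swapping the two vertices) $j=i+1$ in $\mathbb Z_n$ and $x=az_1\cdots z_{k-1}$, $y=z_1\cdots z_{k-1}b$ for some bits $a,b,z_1,\dots,z_{k-1}\in\mathbb Z_2$. The fibre $\mathcal F_i$ is $\{(i,x):x\in\mathbb Z_2^k\}$. Fibres $\mathcal F_i,\mathcal F_j$ are antipodal if $n$ is even and $i-j\equiv n/2\pmod n$. Two distinct vertices $u,v$ are twins if they have the same open neighborhood, $N(u)=N(v)$. *)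

(* Defs.v *)
From mathcomp Require Import all_boot all_order all_algebra.

Set Implicit Arguments.
Unset Strict Implicit.
Unset Printing Implicit Defensive.

Import GRing.Theory.
Local Open Scope ring_scope.

(** Graphs on a finite vertex type are symmetric irreflexive relations. *)

Definition nbhd (T : finType) (e : rel T) (u : T) : {set T} :=
  [set v | e u v].

Definition twins (T : finType) (e : rel T) (u v : T) : bool :=
  (u != v) && (nbhd e u == nbhd e v).

(** Praeger-Xu graphs. ['Z_n] is the ring of integers modulo [n] only for
    [1 < n], and [PX n k] is meant for [3 <= n] and [1 <= k < n]. *)

Definition PXvertex (n k : nat) : finType := ('Z_n * k.-tuple 'Z_2)%type.

Definition PXarc (n k : nat) (u v : PXvertex n k) : bool :=
  (v.1 == u.1 + 1) &&
  [exists a : 'Z_2, exists b : 'Z_2, exists z : k.-1.-tuple 'Z_2,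
    (u.2 == a :: z :> seq 'Z_2) && (v.2 == rcons z b :> seq 'Z_2)].

Definition PX (n k : nat) : rel (PXvertex n k) :=
  fun u v => PXarc u v || PXarc v u.

Lemma PX_sym (n k : nat) : symmetric (@PX n k).
Proof. by move=> u v; rewrite /PX orbC. Qed.

Lemma PX_irrefl (n k : nat) : irreflexive (@PX n k).
Proof.
move=> u; rewrite /PX orbb /PXarc -[X in X == _]addr0 (inj_eq (addrI _)).
by rewrite eq_sym oner_eq0.
Qed.

Definition fibre (n k : nat) (i : 'Z_n) : {set PXvertex n k} :=
  [set u : PXvertex n k | u.1 == i].

(** The fibres of indices [i] and [j] are antipodal. *)
Definition antipodal (n : nat) (i j : 'Z_n) : bool :=
  ~~ odd n && (i - j == (n./2)%:R).

(* Main.v *)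
(** For [k = 1] adjacency only sees fibre indices, and the equality
    [{i - 1, i + 1} = {j - 1, j + 1}] forces [i = j], or [j = i + 2] and
    [i = j + 2], i.e. [4 = 0] in ['Z_n].  For [k >= 2], let [v] be a twin of
    [u = (i, x)].  The two successors of [u], which differ in their last bit
    only, cannot both be predecessors of [v], since a predecessor's last bit
    is read off [v]; so [v] lies in the fibre of [u].  The successors of [u]
    then determine all bits of [x] but the first, and its predecessors all
    bits but the last. *)
Require Import Defs.
From mathcomp Require Import all_boot all_order all_algebra.

Lemma Zp_natr_eq0 (n m : nat) : 1 < n -> (m%:R == 0 :> 'Z_n)%R = (n %| m).
Proof. by move=> n_gt1; rewrite -val_eqE /= val_Zp_nat. Qed.

(** For [n >= 3] the element 2 of ['Z_n] is nonzero, so the successors and the predecessors of a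
    vertex lie in different fibres. *)
Lemma Zp_add2r_neq (n : nat) (i : 'Z_n) : 2 < n -> (i + 1 + 1 != i)%R.
Proof.
move=> n_gt2; rewrite -GRing.addrA -{2}[i]GRing.addr0.
rewrite (inj_eq (GRing.addrI i)) (Zp_natr_eq0 n 2) ?(ltnW n_gt2) //.
by rewrite gtnNdvd.
Qed.

Lemma rcons_take_last (T : Type) (a : T) (m : nat) (s : seq T) :
  size s = m.+1 -> rcons (take m s) (last a s) = s.
Proof.
case/lastP: s => [//|s b]; rewrite size_rcons => -[<-].
by rewrite last_rcons -[in take _ _]cats1 take_size_cat.
Qed.

(** The existential witnesses are forced: [z] is the overlap, [a] the first bit of [u.2] and [b] the
    last bit of [v.2]. *)
Lemma PXarcE (n m : nat) (u v : PXvertex n m.+1) :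
  PXarc u v = (v.1 == u.1 + 1)%R && (behead u.2 == take m v.2).
Proof.
rewrite /PXarc; congr (_ && _); apply/existsP/eqP.
  move=> [a /existsP[b /existsP[z /andP[/eqP -> /eqP ->]]]].
  by rewrite /= -cats1 take_size_cat ?size_tuple.
case: u v => [i x] [j y] /= xy.
exists (thead x); apply/existsP; exists (last 0%R y).
apply/existsP; exists (behead_tuple x) => /=.
by rewrite {1}(tuple_eta x) eqxx /= xy rcons_take_last ?size_tuple.
Qed.

Lemma PX1E (n : nat) (u v : PXvertex n 1) :
  PX u v = (v.1 == u.1 + 1)%R || (u.1 == v.1 + 1)%R.
Proof.
have behead1 (x : 1.-tuple 'Z_2) : behead x = [::].
  by apply: size0nil; rewrite size_behead size_tuple.
by rewrite /PX !PXarcE !behead1 !take0 eqxx !andbT.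
Qed.

Lemma twins_PX (T : finType) (e : rel T) (u v : T) :
  twins e u v -> e u =1 e v.
Proof. by case/andP=> _ /eqP/setP uv w; have := uv w; rewrite !inE. Qed.

Lemma PX1_twinsP (n : nat) (u v : PXvertex n 1) : 2 < n -> u != v ->
  twins (@PX n 1) u v <-> u.1 = v.1 \/ (n = 4 /\ antipodal u.1 v.1).
Proof.
move=> n_gt2 uv; split=> [/twins_PX tw|].
  have [-> | neq] := eqVneq u.1 v.1; [by left | right].
  (* The bit of the test vertex is irrelevant by [PX1E]. As [u.1 != v.1], this vertex can only
     precede [v], hence [v.1 = u.1 + 2]. *)
  have := tw (u.1 + 1, v.2)%R.
  rewrite !PX1E /= eqxx (inj_eq (GRing.addIr _)) (negbTE neq) /=.
  move=> /esym/eqP v1E.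
  have := tw (v.1 + 1, v.2)%R.
  rewrite !PX1E /= eqxx (inj_eq (GRing.addIr _)) eq_sym (negbTE neq) /=.
  move=> /eqP u1E.
  have n4 : n = 4.
    have : (4%:R == 0 :> 'Z_n)%R.
      apply/eqP/(GRing.addrI u.1); rewrite GRing.addr0 [RHS]u1E v1E.
      by rewrite !GRing.mulrS GRing.mulr0n GRing.addr0 !GRing.addrA.
    rewrite Zp_natr_eq0 ?(ltnW n_gt2) // => n_dvd4.
    have := dvdn_leq (isT : 0 < 4) n_dvd4.
    by case: (n) n_gt2 n_dvd4 => [|[|[|[|[|?]]]]].
  split=> //; rewrite /antipodal [in odd _]n4 /= u1E [in n./2]n4.
  by rewrite -(GRing.addrA v.1) (GRing.addrC v.1) GRing.addrK.
move=> uv1; rewrite /twins uv; apply/eqP/setP=> w; rewrite !inE !PX1E.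
case: uv1 => [-> // | [n4]]; move: u.1 v.1 w.1.
rewrite n4 /antipodal => i j k.
(* A finite check over the triples of fibre indices in ['Z_4]. *)
by case: i j k => [[|[|[|[|?]]]] ?] [[|[|[|[|?]]]] ?] [[|[|[|[|?]]]] ?].
Qed.

Definition PXsucc {n m : nat} (u : PXvertex n m.+1) (b : 'Z_2) :
  PXvertex n m.+1 := ((u.1 + 1)%R, [tuple of rcons (behead u.2) b]).

(** The [belast] term is [u.2] without its last bit, in a form whose length is visibly [m]. *)
Definition PXpred {n m : nat} (u : PXvertex n m.+1) (a : 'Z_2) :
  PXvertex n m.+1 :=
  ((u.1 - 1)%R, [tuple of a :: belast (thead u.2) (behead_tuple u.2)]).

Lemma PXarc_succE (n m : nat) (u v : PXvertex n m.+1) (b : 'Z_2) :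
  PXarc v (PXsucc u b) = (v.1 == u.1) && (behead v.2 == behead u.2 :> seq _).
Proof.
rewrite PXarcE /= (inj_eq (GRing.addIr _)) eq_sym; congr (_ && (_ == _)).
by rewrite -cats1 take_size_cat // size_behead size_tuple.
Qed.

Lemma PXarc_predE (n m : nat) (u v : PXvertex n m.+1) (a : 'Z_2) :
  PXarc (PXpred u a) v = (v.1 == u.1) && (take m u.2 == take m v.2 :> seq _).
Proof.
rewrite PXarcE /= GRing.subrK; congr (_ && (_ == _)).
rewrite [in RHS](tuple_eta u.2) /= lastI -cats1 take_size_cat //.
by rewrite size_belast size_behead size_tuple.
Qed.

(** With at least two bits, the appended [b], at position [m.+1] of the successor, survives one more
    shift and lands at position [m] of [v.2]. *)
Lemma PXarc_back_succ (n m : nat) (u v : PXvertex n m.+2) (b : 'Z_2) :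
  PXarc (PXsucc u b) v -> v.1 = (u.1 + 1 + 1)%R /\ b = nth 0%R v.2 m.
Proof.
rewrite PXarcE => /andP[/eqP v1 /eqP v2]; split=> //.
have x_size : size (behead u.2) = m.+1 by rewrite size_behead size_tuple.
have <- : nth 0%R (take m.+1 v.2) m = nth 0%R v.2 m by rewrite nth_take.
by rewrite -v2 nth_behead /= nth_rcons x_size ltnn eqxx.
Qed.

Lemma PXarc_back_pred (n m : nat) (u v : PXvertex n m.+1) (a : 'Z_2) :
  PXarc v (PXpred u a) -> u.1 = (v.1 + 1 + 1)%R.
Proof. by rewrite PXarcE => /andP[/eqP /= <- _]; rewrite GRing.subrK. Qed.

Lemma PX_no_twins (n m : nat) (u v : PXvertex n m.+2) :
  2 < n -> ~~ twins (@PX n m.+2) u v.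
Proof.
move=> n_gt2; apply/negP=> /[dup] /andP[/negP uv _] /twins_PX tw; apply: uv.
have succ b : PXarc v (PXsucc u b) || PXarc (PXsucc u b) v.
  by rewrite -/(PX v _) -tw /PX PXarc_succE !eqxx.
have {succ} : PXarc v (PXsucc u 0%R).
  (* If [PXsucc u 0] precedes [v], then [PXsucc u 1] either precedes [v] too, and one bit of [v] is
     both 0 and 1, or follows [v], and [u.1 + 2 = u.1]. *)
  case/orP: (succ 0%R) => [//|/PXarc_back_succ[v1 v2]].
  case/orP: (succ 1%R) => [|/PXarc_back_succ[_]]; last by rewrite -v2.
  by rewrite PXarc_succE v1 (negbTE (Zp_add2r_neq _ _ n_gt2)).
rewrite PXarc_succE => /andP[/eqP uv1 /eqP uv_behead].
(* With the fibres equal, one predecessor suffices: an arc from [v] to it would again give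
   [u.1 + 2 = u.1]. *)
have : PXarc v (PXpred u 0%R) || PXarc (PXpred u 0%R) v.
  by rewrite -/(PX v _) -tw /PX PXarc_predE !eqxx orbT.
case/orP=> [/PXarc_back_pred/eqP|].
  by rewrite uv1 eq_sym (negbTE (Zp_add2r_neq _ _ n_gt2)).
rewrite PXarc_predE => /andP[_ /eqP uv_take].
(* The common prefix has length [m.+1 > 0], so it contains the first bit, the one that [uv_behead]
   misses. *)
have {uv_take} uv_head : thead u.2 = thead v.2.
  move: uv_take; rewrite [in LHS](tuple_eta u.2) [in RHS](tuple_eta v.2) /=.
  by case.
apply/eqP; rewrite [u]surjective_pairing [v]surjective_pairing uv1.
congr (_, _); apply/val_inj.
by rewrite (tuple_eta u.2) (tuple_eta v.2) /= uv_head uv_behead.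
Qed.

Theorem theorem3p1 (n : nat) (hn : 3 <= n) :
  (forall u v : PXvertex n 1, u != v ->
     (twins (@PX n 1) u v <->
        (exists i : 'Z_n, u \in fibre 1 i /\ v \in fibre 1 i) \/
        (n = 4 /\ exists i j : 'Z_n,
           antipodal i j /\ u \in fibre 1 i /\ v \in fibre 1 j)))
  /\
  (forall k : nat, 2 <= k -> k < n ->
     ~ exists u v : PXvertex n k, twins (@PX n k) u v).
Proof.
split=> [u v uv | [|[|k]] // _ _ [u [v]]]; last exact/negP/PX_no_twins.
apply: (iff_trans (PX1_twinsP _ _ _ hn uv)); split.
  case=> [uv1 | [n4 uv_anti]]; [left | right].
    by exists u.1; rewrite !inE uv1 eqxx.
  by split=> //; exists u.1, v.1; rewrite !inE !eqxx.
case=> [[i] | [n4 [i [j [ij]]]]]; rewrite !inE => -[/eqP-> /eqP->]; first by left.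
by right.
Qed.
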